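(* Let $S=S_1S_2S_3\cdots$ be the sequence defined in the context. For almost every $n$ (i.e. all sufficiently large $n$), the number of output bits contributed by $\mathrm{PPM}^*$ when encoding the segment $S_n$, given that it has already processed $S_1S_2\cdots S_{n-1}$, satisfies $$|\mathrm{PPM}^*(S_n\mid S_1\cdots S_{n-1})|\le (2^n+2n+n^2)\log(n^5)+\log\big((n-1)^n n^{2^{n+1}}\big).$$
   Context: Strings are indexed from $0$; $x[i..j]$ is the substring from position $i$ to $j$; $x^j$ is $j$-fold concatenation; $\log$ is base $2$. de Bruijn strings: for $n\ge1$, a de Bruijn string of order $n$ is a binary string $x$ of length $2^n$ such that every $w\in\{0,1\}^n$ occurs exactly once as a substring of $x\cdot x[0..n-2]$. $db(n)$ is the lexicographically least one, produced by Martin's algorithm: start with $x=1^{n-1}$; while possible, append a bit (preferring $0$ over $1$) so that all length-$n$ substrings of $x$ remain distinct; then delete the prefix $1^{n-1}$. For $0\le i<2^n$, $db_i(n)=db(n)[i..2^n-1]\cdot db(n)[0..i-1]$. The sequence $S$: for $n\ge1$ write $n=2^st$ with $t$ odd, let $B_{n,i}=db_i(n)^t$ for $0\le i<2^s$, $S_n=B_{n,0}B_{n,1}\cdots B_{n,2^s-1}$, and $S=S_1S_2\cdots$. The $\mathrm{PPM}^*$ compressor (without exclusion, escape Method C) on binary input: after reading a prefix $x$, each stored context $c$ has, for each bit $b$, a frequency count equal to the number of occurrences of $cb$ in $x$, and an escape count equal to the number of distinct bits that have followed $c$ in $x$; deterministic means escape count $1$. The stored contexts are the empty context and, whenever a string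 $w$ occurs at least twice in $x$, the contexts $wb$ for each bit $b$ such that $wb$ occurs in $x$ followed by a further bit. Relevant contexts are stored contexts that are suffixes of $x$; the current context is the shortest deterministic relevant one, or the longest relevant one if none is deterministic. If the next bit $b$ has count $f>0$ in the current context it is encoded with probability $f/(T+e)$ ($T$ total bit count, $e$ escape count); otherwise an escape is encoded with probability $e/(T+e)$ and the next shorter relevant context becomes current; if $b$ is unseen even in the empty context, after the escape it is encoded with probability $1/2$. The model is then updated after each bit. The number of bits contributed by an encoded bit is $-\log$ of the product of the probabilities (escapes and symbol) used to encode it; $|\mathrm{PPM}^*(S_n\mid S_1\cdots S_{n-1})|$ is the sum of these over all bits of $S_n$ when $S$ is encoded sequentially. *)

(* Defs.v *)
From Stdlib Require Import Reals.
From mathcomp Require Import all_boot.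

Set Implicit Arguments.
Unset Strict Implicit.
Unset Printing Implicit Defensive.

(* Bits: false = 0, true = 1.  Strings are seq bool, indexed from 0. *)

Definition log2 (x : R) : R := Rdiv (ln x) (ln 2).

Definition occ (w x : seq bool) : nat :=
  count (fun i => take (size w) (drop i x) == w) (iota 0 (size x - size w).+1).

Definition windows (n : nat) (x : seq bool) : seq (seq bool) :=
  if n <= size x then [seq take n (drop i x) | i <- iota 0 (size x - n).+1]
  else [::].

Definition martin_step (n : nat) (x : seq bool) : seq bool :=
  if uniq (windows n (rcons x false)) then rcons x false
  else if uniq (windows n (rcons x true)) then rcons x true
  else x.

(** Martin's algorithm: start from 1^(n-1) and append while possible.  At most
    2^n bits can ever be appended (there are 2^n strings of length n), and once
    no bit can be appended the step is the identity, so 2^n iterations run the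
    algorithm to completion.  Finally the prefix 1^(n-1) is deleted. *)
Definition db (n : nat) : seq bool :=
  drop n.-1 (iter (2 ^ n) (martin_step n) (nseq n.-1 true)).

Definition db_rot (n i : nat) : seq bool := rot i (db n).

Definition two_val (n : nat) : nat := logn 2 n.
Definition odd_part (n : nat) : nat := n %/ 2 ^ logn 2 n.

Definition Bblock (n i : nat) : seq bool := flatten (nseq (odd_part n) (db_rot n i)).

Definition Sseg (n : nat) : seq bool :=
  flatten [seq Bblock n i | i <- iota 0 (2 ^ two_val n)].

Definition Sprefix (n : nat) : seq bool :=
  flatten [seq Sseg k | k <- iota 1 n.-1].

(** ---------------- PPM* (no exclusion, escape method C) ---------------- *)

Definition freq (x c : seq bool) (b : bool) : nat := occ (rcons c b) x.

Definition total (x c : seq bool) : nat := freq x c false + freq x c true.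

Definition esc (x c : seq bool) : nat :=
  (0 < freq x c false) + (0 < freq x c true).

Definition deterministic (x c : seq bool) : bool := esc x c == 1.

Definition stored (x c : seq bool) : bool :=
  if c is [::] then true
  else
    let w := take (size c).-1 c in
    (2 <= occ w x) && ((0 < occ (rcons c false) x) || (0 < occ (rcons c true) x)).

(** relevant contexts (stored contexts that are suffixes of x), listed by
    strictly decreasing length; the empty context is always the last one. *)
Definition relevant (x : seq bool) : seq (seq bool) :=
  [seq c <- [seq drop i x | i <- iota 0 (size x).+1] | stored x c].

Definition current (x : seq bool) : seq bool :=
  let rel := relevant x in
  if has (deterministic x) rel then last [::] (filter (deterministic x) rel)
  else head [::] rel.

(** The sequence of probabilities (numerator, denominator) used to encode
    bit b after having read x: starting at the current context, escapes to the
    next shorter relevant context until b has a positive count; if b is unseen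
    even in the empty context, it is finally encoded with probability 1/2. *)
Fixpoint enc_probs (x : seq bool) (b : bool) (cs : seq (seq bool)) : seq (nat * nat) :=
  match cs with
  | [::] => [:: (1, 2)]
  | c :: cs' =>
      let f := freq x c b in
      let d := total x c + esc x c in
      if 0 < f then [:: (f, d)] else (esc x c, d) :: enc_probs x b cs'
  end.

Definition ppm_probs (x : seq bool) (b : bool) : seq (nat * nat) :=
  let rel := relevant x in
  enc_probs x b (drop (index (current x) rel) rel).

Definition ppm_bit_cost (x : seq bool) (b : bool) : R :=
  Ropp (log2 (foldr Rmult R1
            [seq Rdiv (INR p.1) (INR p.2) | p <- ppm_probs x b])).

Definition ppm_cost (hist seg : seq bool) : R :=
  foldr Rplus R0
    [seq ppm_bit_cost (hist ++ take i seg) (nth false seg i) | i <- iota 0 (size seg)].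

(* Main.v *)
Require Import Defs.
From Stdlib Require Import Reals Lra.
From mathcomp Require Import all_boot zify.

(* Cut [Sseg n] into its [n] rotated copies of [db n], put [M = n ^ 4], and call
   a bit regular if it is at offset at least [M] in its copy; a regular bit is
   labelled by the position in the cyclic word [db n] of the [M + 1] bits ending
   with it.  Costs are measured in nats.
   - Each label occurs at most [n] times.  If the [M] bits preceding a regular
     bit are never followed by the opposite bit, then after [r > 0] visits to the
     label the bit is predicted by a deterministic context at cost at most
     [ln ((r + 1) / r)]; this telescopes to [ln n] per label.
   - The first visit to a label costs at most [2 ln (k + 2)], where [k] counts the
     occurrences of the previous [n - 3] bits; since [k] is [O(n)] on average over
     the labels, concavity of [ln] gives [2 ln n + O(1)] on average.
   - If the opposite bit does occur after those [M] bits, the positions of these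
     occurrences are pairwise more than [M - n] apart, because [n] bits of the
     cyclic word determine the next one.  So few labels are concerned, and like
     the irregular bits they contribute a negligible amount.
   The total [2 ^ n (3 ln n + O(1))] is below the first term of the bound. *)

Set Implicit Arguments.
Unset Strict Implicit.
Unset Printing Implicit Defensive.

(** * PPM* contexts *)

(** Positions beyond [size x - size w] leave fewer than [size w] letters, so letting [i] run over
    all suffixes adds nothing and makes the count recursive in [x]. *)
Lemma occE w x :
  occ w x = count (fun i => prefix w (drop i x)) (iota 0 (size x).+1).
Proof.
rewrite /occ.
have -> : (size x).+1 = (size x - size w).+1 + minn (size w) (size x) by lia.
rewrite iotaD count_cat addnC [X in X + _](_ : _ = 0) ?add0n; last first.
  apply/eqP; rewrite -leqn0 leqNgt -has_count; apply/hasPn => /= i.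
  rewrite mem_iota => /andP[h1 h2]; apply/negP => /size_prefix.
  by rewrite size_drop => h3; simpl in *; lia.
by apply: eq_count => i; rewrite prefixE.
Qed.

Lemma occ_nil w : occ w [::] = (w == [::]).
Proof. by rewrite occE; case: w. Qed.

Lemma occ_cons w a x : occ w (a :: x) = prefix w (a :: x) + occ w x.
Proof.
rewrite !occE -[(size (a :: x)).+1]add1n iotaD count_cat (iotaDl 1 0) count_map.
by congr (_ + _); rewrite /= ?addn0.
Qed.

Lemma occ_consl a w y x : occ (a :: w) (y :: x) <= occ w x.
Proof.
elim: x y => [|z x IH] y; rewrite occ_cons.
  by rewrite !occ_nil addn0; case: w => /=; case: eqP.
rewrite [leqRHS]occ_cons; apply: leq_add; last exact: IH.
by rewrite /=; case: eqP.
Qed.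

Lemma occ_suffix a w x : occ (a ++ w) x <= occ w x.
Proof.
elim: a => //= y a IH; apply: leq_trans IH.
case: x => [|z x]; first by rewrite !occ_nil.
by apply: leq_trans (occ_consl _ _ _ _) _; rewrite occ_cons leq_addl.
Qed.

Lemma occ_infix w x : (0 < occ w x) = infix w x.
Proof.
elim: x => [|a x IH]; first by rewrite occ_nil infixs0; case: eqP.
rewrite occ_cons addn_gt0 IH -[RHS]/(prefix w (a :: x) || infix w x).
by case: prefix.
Qed.

Lemma occ_le_size w x : occ w x <= (size x).+1.
Proof. by rewrite occE -[X in _ <= X](size_iota 0) count_size. Qed.

Lemma occ_oversize w x : size x < size w -> occ w x = 0.
Proof.
move=> h; apply/eqP; rewrite -leqn0 leqNgt occ_infix.
by apply/negP => /size_infix; rewrite leqNgt h.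
Qed.

Lemma prefix_rcons_add c (s : seq bool) :
  prefix (rcons c false) s + prefix (rcons c true) s =
  prefix c s && (size c < size s).
Proof.
elim: c s => [|a c IH] [|b s] //; last first.
  by rewrite !rcons_cons /= -[RHS]/(nat_of_bool ((a == b) && prefix c s && (size c < size s)));
    rewrite -andbA; case: eqP => //= _; exact: IH.
by case: b; case: s.
Qed.

Lemma total_le_occ x c : Defs.total x c <= occ c x.
Proof.
rewrite /Defs.total /freq; elim: x => [|a x IH].
  by rewrite !occ_nil; case: c.
rewrite !occ_cons addnACA prefix_rcons_add; apply: leq_add => //.
by case: prefix => //=; case: ltnP.
Qed.

(** The occurrence of [c] at the end of [x] is not yet followed by a bit, so it counts in [occ] but
    not in [total]. *)
Lemma total_lt_occ x c : suffix c x -> Defs.total x c < occ c x.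
Proof.
case/suffixP => y ->; elim: y => [|a y IH].
  rewrite /Defs.total /freq !(@occ_oversize (rcons c _)) ?size_rcons //.
  by rewrite occ_infix infix_refl.
rewrite cat_cons; move: IH; set s := y ++ c => IH.
rewrite /Defs.total /freq !occ_cons addnACA prefix_rcons_add -addnS.
by apply: leq_add => //; case: prefix => //=; case: ltnP.
Qed.

Lemma freq_le_total x c b : freq x c b <= Defs.total x c.
Proof. by rewrite /Defs.total; case: b; [apply: leq_addl|apply: leq_addr]. Qed.

Lemma esc_gt0 x c b : 0 < freq x c b -> 0 < esc x c.
Proof. by rewrite /esc; case: b => ->; rewrite ?addn1. Qed.

Lemma suffix_ex (c x : seq bool) : suffix c x -> exists y : seq bool, x = y ++ c.
Proof. by case/suffixP=> y ->; exists y. Qed.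

Lemma suffix_nested (d c x : seq bool) :
  suffix d x -> suffix c x -> size d <= size c -> suffix d c.
Proof.
case/suffix_ex => y2 e2 /suffix_ex[y1 e1] dc.
have := congr1 size e1; rewrite {1}e2 !size_cat => es.
have -> : d = drop (size c - size d) c; last exact: suffix_drop.
rewrite -[LHS](drop_size_cat d (erefl (size y2))) -e2 e1 drop_cat ifF; last by lia.
by congr (drop _ _); lia.
Qed.

Lemma mem_relevant x (c : seq bool) : (c \in relevant x) = stored x c && suffix c x.
Proof.
rewrite mem_filter; congr (_ && _); apply/mapP/suffixP.
  by case=> i _ ->; exists (take i x); rewrite cat_take_drop.
case=> y ->; exists (size y); first by rewrite mem_iota size_cat leq0n add0n ltnS leq_addr.
by rewrite drop_size_cat.
Qed.

Lemma suffixes_pairwise (x : seq bool) :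
  pairwise (fun a b : seq bool => size b < size a)
    [seq drop i x | i <- iota 0 (size x).+1].
Proof.
elim: x => [//|a x IH].
rewrite (_ : iota 0 _ = 0 :: [seq 1 + i | i <- iota 0 (size x).+1]); last first.
  by rewrite -(iotaDl 1 0).
rewrite map_cons -map_comp pairwise_cons drop0; apply/andP; split; last exact: IH.
by apply/allP => c /mapP[i _ ->] /=; rewrite size_drop ltnS leq_subr.
Qed.

Lemma relevant_pairwise x :
  pairwise (fun a b : seq bool => size b < size a) (relevant x).
Proof. exact: pairwise_filter (suffixes_pairwise x). Qed.

Lemma last_filter_split (T : eqType) (d : T) (p : pred T) s :
  has p s -> exists s1 c s2,
    [/\ s = s1 ++ c :: s2, p c, ~~ has p s2 & last d (filter p s) = c].
Proof.
elim: s d => //= a s IH d; case hs: (has p s) => ha.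
  have [s1 [c [s2 [e1 e2 e3 e4]]]] := IH a hs.
  exists (a :: s1), c, s2; split=> //; first by rewrite e1.
  move: hs e4; rewrite has_filter.
  by case: (p a) => //; case: (filter p s).
rewrite orbF in ha; exists [::], a, s; rewrite ha hs; split=> //.
by move: hs; rewrite has_filter; case: (filter p s).
Qed.

(** Exposes the escape list [c :: s2] that [enc_probs] traverses. Lengths strictly decrease along
    [relevant x], so [c] is not in [s1] and [index] stops at it. *)
Lemma current_split x : exists (s1 : seq (seq bool)) (c : seq bool) (s2 : seq (seq bool)),
  [/\ relevant x = s1 ++ c :: s2,
      drop (index (current x) (relevant x)) (relevant x) = c :: s2,
      ~~ has (deterministic x) s2
    & deterministic x c \/ s1 = [::] /\ ~~ deterministic x c].
Proof.
have hdrop s1 c s2 : relevant x = s1 ++ c :: s2 ->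
    drop (index c (relevant x)) (relevant x) = c :: s2.
  move=> e; have := relevant_pairwise x.
  rewrite e pairwise_cat => /and3P[/allrelP h _ _].
  rewrite index_cat ifF /= ?eqxx ?addn0 ?drop_size_cat //.
  apply/negP => hc; have := h c c hc (mem_head _ _); by rewrite ltnn.
rewrite /current; case hd: (has _ _).
  have [s1 [c [s2 [e1 e2 e3 e4]]]] := last_filter_split [::] hd.
  exists s1, c, s2; rewrite e4; split=> //.
  - exact: hdrop e1.
  by left.
have : [::] \in relevant x by rewrite mem_relevant /= suffix0s.
case e: (relevant x) => [//|c s2] _ /=; exists [::], c, s2; split=> //.
- by rewrite eqxx.
- by move: hd; rewrite e /= => /norP[].
- by right; split=> //; move: hd; rewrite e /= => /norP[].
Qed.

(** * The coding cost of a single bit *)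

Definition bit_nats (x : seq bool) (b : bool) : R := Rmult (ppm_bit_cost x b) (ln 2).

Lemma ln2_gt0 : Rlt 0 (ln 2).
Proof. by rewrite -ln_1; apply: ln_increasing; lra. Qed.

Lemma bit_natsE x b :
  bit_nats x b = Ropp (ln (foldr Rmult R1
    [seq Rdiv (INR p.1) (INR p.2) | p <- ppm_probs x b])).
Proof.
rewrite /bit_nats /ppm_bit_cost /log2; field.
by have := ln2_gt0; lra.
Qed.

Lemma nlog_frac (f d : nat) : 0 < f -> 0 < d ->
  Ropp (ln (Rdiv (INR f) (INR d))) = Rminus (ln (INR d)) (ln (INR f)).
Proof.
move=> f0 d0; have Hf : Rlt 0 (INR f) by apply: lt_0_INR; lia.
have Hd : Rlt 0 (INR d) by apply: lt_0_INR; lia.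
rewrite /Rdiv ln_mult ?ln_Rinv //; first by lra.
exact: Rinv_0_lt_compat.
Qed.

Lemma ln_le x y : Rlt 0 x -> Rle x y -> Rle (ln x) (ln y).
Proof.
move=> x0 [xy|->]; last exact: Rle_refl.
exact/Rlt_le/ln_increasing.
Qed.

Lemma ln_INR_le (a b : nat) : 0 < a -> a <= b -> Rle (ln (INR a)) (ln (INR b)).
Proof.
move=> a0 ab; apply: ln_le; first by apply: lt_0_INR; lia.
by apply: le_INR; lia.
Qed.

Lemma ln_INR_ge0 (a : nat) : Rle 0 (ln (INR a)).
Proof.
case: a => [|a].
  unfold ln; destruct (Rlt_dec 0 (INR 0)) as [h|h]; last exact: Rle_refl.
  by exfalso; move: h => /=; lra.
rewrite -ln_1; exact: (@ln_INR_le 1).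
Qed.

Definition suff (q : nat) (x : seq bool) := drop (size x - q) x.

(** Once all strings of size [q.+1] have been seen, the suffix of size [q] is
    a non-deterministic relevant context, so at most one escape is coded and
    both contexts involved are at least as long as that suffix. *)
Lemma bit_nats_full q x b :
  (forall w, size w <= q.+1 -> 0 < occ w x) ->
  Rle (bit_nats x b) (Rmult 2 (ln (INR (occ (suff q x) x).+2))).
Proof.
move=> full.
have esc2 c : size c <= q -> esc x c = 2.
  by move=> h; rewrite /esc /freq !full ?size_rcons.
have ndet c : size c <= q -> deterministic x c = false.
  by move=> h; rewrite /deterministic esc2.
have qx : q < size x.
  have := full (nseq q.+1 true); rewrite size_nseq leqnn => /(_ isT).
  by rewrite occ_infix => /size_infix; rewrite size_nseq.
set v := suff q x; set K := occ v x; set L := ln (INR K.+2).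
have sv : size v = q by rewrite /v /suff size_drop; lia.
have svx : suffix v x.
  by apply/suffixP; exists (take (size x - q) x); rewrite cat_take_drop.
have vrel : v \in relevant x.
  rewrite mem_relevant svx andbT /stored.
  case: v sv {svx K L} => // a v sv.
  rewrite -!/(is_true (0 < _)) !full ?size_rcons ?sv //= andbT.
  set w := take _ _; have hw : size w <= q by rewrite size_take; case: ifP; lia.
  (* Both one-bit extensions of [w] occur, which makes two occurrences of [w]. *)
  apply: leq_trans (total_le_occ x w); rewrite /Defs.total /freq.
  have h1 := full (rcons w false); have h2 := full (rcons w true).
  rewrite !size_rcons in h1 h2; have := h1 hw; have := h2 hw; lia.
have totK (c : seq bool) : c \in relevant x -> q <= size c -> Defs.total x c < K.+1.
  rewrite mem_relevant => /andP[_ sc] hc.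
  apply: leq_trans (total_lt_occ sc) _; apply: leqW.
  have [y ->] := suffix_ex (suffix_nested svx sc ltac:(by rewrite sv)).
  exact: occ_suffix.
have cesc (c : seq bool) : c \in relevant x -> 0 < esc x c.
  rewrite mem_relevant => /andP[+ _]; case: c => [|a c]; first by rewrite esc2.
  by case/andP=> _ /orP[] h; [apply: (@esc_gt0 _ _ false)|apply: (@esc_gt0 _ _ true)].
have cesc2 (c : seq bool) b' : c \in relevant x -> ~~ deterministic x c ->
    esc x c = 2 /\ 0 < freq x c b'.
  move=> hc hd; have := cesc c hc; move: hd; rewrite /deterministic /esc.
  case: b'; do 2 case: (0 < freq _ _ _) => //=.
have [s1 [c [s2 [e1 e2 e3 e4]]]] := current_split x.
rewrite bit_natsE /ppm_probs e2.
have crel : c \in relevant x by rewrite e1 mem_cat mem_head orbT.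
have := relevant_pairwise x; rewrite e1 pairwise_cat /=.
case/and3P => /allrelP h12 _ /andP[/allP h2 h2'].
(* If [v] were longer than the current context [c], then [c] would be non-deterministic, hence the
   longest relevant context. *)
have vc : v = c \/ v \in s2.
  move: vrel; rewrite e1 mem_cat in_cons => /or3P[vs1|/eqP|]; [|by left|by right].
  have hs := h12 v c vs1 (mem_head _ _); rewrite sv in hs.
  case: e4 => [|[e _]]; last by rewrite e in vs1.
  by rewrite ndet // ltnW.
have csz : q <= size c.
  case: vc => [<-|/h2]; first by rewrite sv.
  by rewrite sv => /ltnW.
have hK (d : nat) : 0 < d -> d <= K.+2 -> Rle (ln (INR d)) L.
  by move=> *; apply: ln_INR_le.
have K0 : Rle 0 L := ln_INR_ge0 K.+2.
have tc := totK c crel csz.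
case: ifP => hf /=.
  rewrite Rmult_1_r nlog_frac //; last by have := freq_le_total x c b; lia.
  have := ln_INR_ge0 (freq x c b).
  have := hK (Defs.total x c + esc x c).
  case: e4 => [/eqP -> | [_ /(cesc2 _ b crel) [-> _]]]; last first.
    by move=> /(_ ltac:(lia) ltac:(lia)); lra.
  by move=> /(_ ltac:(lia) ltac:(lia)); lra.
(* An escape happens only from a deterministic [c]; the next context [c'] is non-deterministic, so
   it has seen [b] and no second escape follows. *)
case: e4 => [dc|[_ /(cesc2 _ b crel) [_]]]; last by rewrite hf.
have {vc} : v \in s2.
  by case: vc => // e; rewrite -e ndet ?sv in dc.
case: s2 e1 e2 e3 h2 h2' {h12} => [//|c' s2] e1 _ /norP[dc' _] _ /andP[/allP h2' _] vs2.
have crel' : c' \in relevant x by rewrite e1 mem_cat !in_cons eqxx !orbT.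
have csz' : q <= size c'.
  move: vs2; rewrite in_cons => /orP[/eqP <-|/h2']; first by rewrite sv.
  by rewrite sv => /ltnW.
have [ee hf'] := cesc2 c' b crel' dc'.
have tc' := totK c' crel' csz'.
rewrite /= hf' /= Rmult_1_r (eqP dc) ee.
rewrite ln_mult; first last.
- apply: Rdiv_lt_0_compat; apply: lt_0_INR; lia.
- apply: Rdiv_lt_0_compat; apply: lt_0_INR; lia.
have := @nlog_frac 1 (Defs.total x c + 1) isT ltac:(lia).
have := @nlog_frac (freq x c' b) (Defs.total x c' + 2) hf' ltac:(lia).
have := hK (Defs.total x c + 1) ltac:(lia) ltac:(lia).
have := hK (Defs.total x c' + 2) ltac:(lia) ltac:(lia).
have := ln_INR_ge0 (freq x c' b); have : ln (INR 1) = R0 := ln_1.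
lra.
Qed.

(** Here [c] is relevant and deterministic, so the current context [d] is a deterministic suffix of
    it. It has seen only [b], some [F >= f] times, and [ln ((F + 1) / F)] decreases in [F]. *)
Lemma bit_nats_predicted (x c : seq bool) b f :
  suffix c x -> 0 < f -> f <= occ (rcons c b) x -> occ (rcons c (~~ b)) x = 0 ->
  Rle (bit_nats x b) (Rminus (ln (Rplus (INR f) 1)) (ln (INR f))).
Proof.
move=> sc fpos fle nf; have f0 : 0 < occ (rcons c b) x by apply: leq_trans fle.
have detc : deterministic x c.
  by move: f0 nf; rewrite /deterministic /esc /freq; case: (b) => /= -> ->.
have crel : c \in relevant x.
  rewrite mem_relevant sc andbT /stored; case: c sc f0 fle nf detc => // a c sc f0 fle nf detc.
  apply/andP; split; last by case: (b) f0 => ->; rewrite ?orbT.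
  set w := take _ _.
  have ew : a :: c = rcons w (last a c).
    rewrite /w [LHS]lastI; congr (rcons _ _).
    by rewrite [in RHS]lastI -cats1 take_size_cat // size_cat size_belast addn1.
  (* An occurrence of [a :: c] followed by [b] and the final one give two occurrences of [w], as
     [stored] requires. *)
  have h1 := total_lt_occ sc.
  have h2 := freq_le_total x (a :: c) b.
  have h3 : occ (a :: c) x <= occ w x.
    by rewrite ew; apply: leq_trans (total_le_occ x w); exact: (freq_le_total x w).
  by move: h2; rewrite /freq; lia.
have [s1 [d [s2 [e1 e2 e3 e4]]]] := current_split x.
have := relevant_pairwise x; rewrite e1 pairwise_cat /=.
case/and3P => /allrelP h12 _ _.
have dd : deterministic x d.
  case: e4 => // -[e /negP h]; move: crel; rewrite e1 e /= in_cons.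
  by case/orP=> [/eqP e'|hs]; [rewrite -e' in h | case/hasP: e3; exists c].
have cd : size d <= size c.
  move: crel; rewrite e1 mem_cat in_cons => /or3P[hs|/eqP -> //|hs].
    by apply: ltnW; apply: h12 => //; rewrite mem_head.
  by case/hasP: e3; exists c.
have sd : suffix d x.
  have : d \in relevant x by rewrite e1 mem_cat mem_head orbT.
  by rewrite mem_relevant => /andP[].
have [y ey] := suffix_ex (suffix_nested sd sc cd).
have ff : f <= freq x d b.
  by apply: leq_trans fle _; rewrite ey rcons_cat occ_suffix.
have tot : Defs.total x d = freq x d b.
  move: dd ff; rewrite /deterministic /esc /Defs.total => /eqP.
  by case: (b); case: (posnP (freq x d false)) => h1; case: (posnP (freq x d true)) => h2;
    rewrite ?h1 ?h2 /=; lia.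
rewrite bit_natsE /ppm_probs e2 /= (_ : 0 < freq x d b); last by apply: leq_trans fpos ff.
rewrite /= Rmult_1_r tot (eqP dd) nlog_frac ?addn1 ?S_INR //; last by apply: leq_trans fpos ff.
have hlt (k : nat) : 0 < k -> Rlt 0 (INR k) by move=> ?; apply: lt_0_INR; lia.
have k0 : 0 < freq x d b by apply: leq_trans fpos ff.
have e (k : nat) : 0 < k ->
    Rminus (ln (Rplus (INR k) 1)) (ln (INR k)) = ln (Rplus 1 (Rinv (INR k))).
  move=> hk; have h := hlt k hk.
  rewrite (_ : Rplus (INR k) 1 = Rmult (INR k) (Rplus 1 (Rinv (INR k)))).
    rewrite ln_mult //; first by lra.
    by have := Rinv_0_lt_compat _ h; lra.
  by field; lra.
rewrite !e //; apply: ln_le.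
  by have := Rinv_0_lt_compat _ (hlt _ k0); lra.
apply: Rplus_le_compat_l; apply: Rinv_le_contravar; first exact: hlt.
by apply: le_INR; lia.
Qed.

(** * Martin's algorithm yields de Bruijn strings *)

Definition win (n : nat) (x : seq bool) (i : nat) := take n (drop i x).

Lemma size_win n x i : i + n <= size x -> size (win n x i) = n.
Proof. by move=> h; rewrite size_take size_drop; case: ltnP; lia. Qed.

Lemma mem_windows n x (w : seq bool) :
  reflect (exists2 i, i + n <= size x & win n x i = w) (w \in windows n x).
Proof.
rewrite /windows; case: leqP => h; last first.
  by rewrite in_nil; constructor; case=> i; lia.
apply: (iffP mapP) => [[i]|[i hi <-]]; last by exists i => //; rewrite mem_iota; lia.
by rewrite mem_iota => hi ->; exists i => //; lia.
Qed.

Lemma win_inj n x i j : uniq (windows n x) -> i + n <= size x -> j + n <= size x ->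
  win n x i = win n x j -> i = j.
Proof.
rewrite /windows => + hi hj; rewrite ifT; last by lia.
move=> /(uniqP [::]) inj e; apply: inj; rewrite ?inE ?size_map ?size_iota; try lia.
rewrite !(nth_map 0) ?size_iota ?nth_iota //; lia.
Qed.

Lemma windows_rcons n x b : 0 < n -> n.-1 <= size x ->
  windows n (rcons x b) = rcons (windows n x) (rcons (suff n.-1 x) b).
Proof.
move=> n0 hn; rewrite /windows size_rcons ifT; last by lia.
case: leqP => h; last first.
  have -> : (size x).+1 - n = 0 by lia.
  rewrite /= drop0 take_oversize ?size_rcons //.
  by rewrite /suff (_ : size x - n.-1 = 0) ?drop0 //; lia.
have -> : ((size x).+1 - n).+1 = (size x - n).+1 + 1 by lia.
rewrite iotaD map_cat cats1 add0n; congr rcons.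
  apply/eq_in_map => i; rewrite mem_iota; move: i => /= i hi.
  rewrite drop_rcons; last by lia.
  by rewrite -cats1 takel_cat // size_drop; lia.
rewrite drop_rcons; last by lia.
rewrite take_oversize; last by rewrite size_rcons size_drop; lia.
by rewrite /suff; congr (rcons (drop _ _) _); lia.
Qed.

Lemma size_windows n x : n <= size x -> size (windows n x) = (size x - n).+1.
Proof. by move=> h; rewrite /windows h size_map size_iota. Qed.

Lemma windows_size_mem n x (w : seq bool) : w \in windows n x -> size w = n.
Proof.
by case/mem_windows => i hi <-; rewrite size_win.
Qed.

Lemma card_strings n (s : seq (seq bool)) :
  uniq s -> {in s, forall w, size w = n} -> size s <= 2 ^ n.
Proof.
move=> us hs; rewrite -card_bool -card_tuple cardE -(size_map val).
apply: uniq_leq_size => // w hw; have /eqP sw := hs w hw.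
by apply/mapP; exists (Tuple sw); rewrite ?mem_enum.
Qed.

Lemma card_strings_ge n (s : seq (seq bool)) :
  (forall w, size w = n -> w \in s) -> 2 ^ n <= size s.
Proof.
move=> hs; rewrite -card_bool -card_tuple cardE -(size_map val).
apply: uniq_leq_size => [|_ /mapP[t _ ->]]; last by apply: hs; rewrite size_tuple.
by rewrite map_inj_uniq ?enum_uniq //; exact: val_inj.
Qed.

(** The last clause is the trace of the preference for 0: a 1 is appended only when the window
    ending in 0 is already present. *)
Definition martin_inv (n : nat) (x : seq bool) : Prop :=
  [/\ exists y, x = nseq n.-1 true ++ y, uniq (windows n x) &
      forall v : seq bool, rcons v true \in windows n x -> rcons v false \in windows n x].

Lemma martin_inv_step n x : 0 < n -> martin_inv n x -> martin_inv n (martin_step n x).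
Proof.
move=> n0 [[y ex] ux hx].
have sx : n.-1 <= size x by rewrite ex size_cat size_nseq leq_addr.
rewrite /martin_step; case: ifP => h0.
  split=> //; first by exists (rcons y false); rewrite ex rcons_cat.
  move=> v; rewrite windows_rcons // !mem_rcons !in_cons eqseq_rcons andbF /=.
  by move=> /hx ->; rewrite orbT.
case: ifP => h1; last by split=> //; exists y.
split=> //; first by exists (rcons y true); rewrite ex rcons_cat.
move=> v; rewrite windows_rcons // !mem_rcons !in_cons eqseq_rcons andbT.
case/orP => [/eqP ->|/hx ->]; last by rewrite orbT.
by move: h0; rewrite windows_rcons // rcons_uniq ux andbT => /negbFE ->; rewrite orbT.
Qed.

Lemma martin_inv_start n : 0 < n -> martin_inv n (nseq n.-1 true).
Proof.
move=> n0; have e : windows n (nseq n.-1 true) = [::].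
  by rewrite /windows size_nseq ifF //; lia.
by split; rewrite ?e //; exists [::]; rewrite cats0.
Qed.

Lemma size_martin_step n x : martin_step n x = x \/ size (martin_step n x) = (size x).+1.
Proof.
by rewrite /martin_step; do 2 (case: ifP => _; first by right; rewrite size_rcons); left.
Qed.

Definition martin (n : nat) := iter (2 ^ n) (martin_step n) (nseq n.-1 true).

Lemma martin_invP n : 0 < n -> martin_inv n (martin n).
Proof.
move=> n0; rewrite /martin; elim: (2 ^ n) => [|k IH]; first exact: martin_inv_start.
exact: martin_inv_step.
Qed.

(** If the string still grew at step [2 ^ n + 1], it would have [2 ^ n + 1] distinct windows of
    length [n]. *)
Lemma martin_fixed n : 0 < n -> martin_step n (martin n) = martin n.
Proof.
move=> n0; set f := martin_step n; set x0 := nseq n.-1 true.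
have main k : f (iter k f x0) = iter k f x0 \/ size (iter k.+1 f x0) = n.-1 + k.+1.
  elim: k => [|k [IH|IH]].
  - by case: (size_martin_step n x0) => [?|e]; [left|right; rewrite /= e size_nseq addn1].
  - by left; rewrite /= IH.
  - case: (size_martin_step n (iter k.+1 f x0)) => [?|e]; [by left|right].
    by rewrite [iter k.+2 _ _]/= e IH; lia.
case: (main (2 ^ n)) => // e; exfalso.
have [_ u _] := martin_inv_step n0 (martin_invP n0).
have := card_strings u (@windows_size_mem _ _).
rewrite size_windows; rewrite [martin_step n _]/(iter (2 ^ n).+1 f x0) e; lia.
Qed.

Lemma martin_stuck n b : 0 < n -> rcons (suff n.-1 (martin n)) b \in windows n (martin n).
Proof.
move=> n0; have [[y ex] u _] := martin_invP n0; have := martin_fixed n0.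
have sx : n.-1 <= size (martin n) by rewrite ex size_cat size_nseq leq_addr.
have no c : rcons (martin n) c <> martin n.
  by move=> /(congr1 size); rewrite size_rcons; lia.
rewrite /martin_step; case: ifP => h0; first by move/no.
case: ifP => h1; first by move/no.
move=> _; have : uniq (windows n (rcons (martin n) b)) = false by case: b.
by rewrite windows_rcons // rcons_uniq u andbT => /negbFE.
Qed.

Lemma win_pred n x (v : seq bool) i : 0 < i -> 0 < n -> win n.-1 x i = v ->
  i + n.-1 <= size x -> win n x i.-1 = nth false x i.-1 :: v.
Proof.
case: i => // i _; case: n => // n _ /= e h.
by rewrite /win (drop_nth false) /=; [rewrite -e | lia].
Qed.

Lemma win_behead n x (v : seq bool) b i : 0 < n -> i + n <= size x ->
  win n x i = rcons v b -> win n.-1 x i = v.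
Proof.
case: n => // n _ h; rewrite /win /= => e.
have sv : size v = n.
  have := congr1 size e; rewrite size_take size_rcons size_drop; case: ltnP; lia.
by rewrite -(@take_takel _ n n.+1) // e -cats1 take_size_cat.
Qed.

Section Stuck.
Variables (n : nat) (n0 : 0 < n).
Let x := martin n.

Lemma martin_uniq : uniq (windows n x).
Proof. by case: (martin_invP n0). Qed.

Lemma nsize_martin : n.-1 <= size x.
Proof.
case: (martin_invP n0) => -[y]; rewrite -/x => -> _ _.
by rewrite size_cat size_nseq leq_addr.
Qed.

Lemma martin_prefix : win n.-1 x 0 = nseq n.-1 true.
Proof.
case: (martin_invP n0) => -[y]; rewrite -/x => -> _ _.
by rewrite /win drop0 take_size_cat // size_nseq.
Qed.

(** Two non-initial occurrences of [v] are preceded by different bits, since otherwise a window of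
    length [n] would repeat; so both bits precede [v]. *)
Lemma martin_two (v : seq bool) i j a : win n.-1 x i = v -> win n.-1 x j = v ->
  0 < i -> 0 < j -> i != j -> i + n.-1 <= size x -> j + n.-1 <= size x ->
  a :: v \in windows n x.
Proof.
move=> ei ej i0 j0 ij hi hj.
have wi := win_pred i0 n0 ei hi; have wj := win_pred j0 n0 ej hj.
have ne : nth false x i.-1 != nth false x j.-1.
  apply: contra ij => /eqP e; apply/eqP.
  suff : i.-1 = j.-1 by lia.
  by apply: (win_inj martin_uniq); rewrite ?wi ?wj ?e //; lia.
have [->|->] : a = nth false x i.-1 \/ a = nth false x j.-1.
  by move: ne; case: a; case: nth; case: nth => //; auto.
- by apply/mem_windows; exists i.-1 => //; lia.
- by apply/mem_windows; exists j.-1 => //; lia.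
Qed.

(* Three occurrences of [suff n.-1 x], none of them initial, would be preceded
   by only two different bits. *)
Lemma martin_end : suff n.-1 x = nseq n.-1 true.
Proof.
set v := suff n.-1 x; have sv : size v = n.-1.
  by rewrite /v /suff size_drop; have := nsize_martin; lia.
have /mem_windows[i hi ei] := martin_stuck false n0.
have /mem_windows[j hj ej] := martin_stuck true n0.
have ij : i != j.
  apply/eqP => e; move: ei; rewrite e ej => /eqP.
  by rewrite eqseq_rcons andbF.
have vi := win_behead n0 hi ei; have vj := win_behead n0 hj ej.
rewrite -/x -/v in vi vj hi hj.
have ve : win n.-1 x (size x - n.-1) = v by rewrite /win take_oversize // -/(suff _ _) sv.
case: (posnP i) => [i0|i0]; first by rewrite -vi i0 martin_prefix.
case: (posnP j) => [j0|j0]; first by rewrite -vj j0 martin_prefix.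
set e := size x - n.-1 in ve *.
have wi := win_pred i0 n0 vi ltac:(lia); have wj := win_pred j0 n0 vj ltac:(lia).
have we := win_pred (i := e) ltac:(lia) n0 ve ltac:(lia).
have key k l : k.+1 != l.+1 -> k + n <= size x -> l + n <= size x ->
    win n x k = nth false x k :: v -> win n x l = nth false x l :: v ->
    nth false x k != nth false x l.
  move=> kl hk hl ek el; apply: contra kl => /eqP e'; rewrite eqSS.
  by apply/eqP; apply: (win_inj martin_uniq); rewrite ?ek ?el ?e'.
have := key i.-1 j.-1 ltac:(lia) ltac:(lia) ltac:(lia) wi wj.
have := key i.-1 e.-1 ltac:(lia) ltac:(lia) ltac:(lia) wi we.
have := key j.-1 e.-1 ltac:(lia) ltac:(lia) ltac:(lia) wj we.
by case: nth; case: nth; case: nth.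
Qed.

(** An initial occurrence has no predecessor, but then [v] is [1^(n-1)], and by [martin_end] the
    final occurrence can replace it. *)
Lemma martin_into (v : seq bool) a :
  rcons v false \in windows n x -> rcons v true \in windows n x ->
  a :: v \in windows n x.
Proof.
move=> /mem_windows[i hi ei] /mem_windows[j hj ej].
have ij : i != j.
  apply/eqP => e; move: ei; rewrite e ej => /eqP.
  by rewrite eqseq_rcons andbF.
have vi := win_behead n0 hi ei; have vj := win_behead n0 hj ej.
set e := size x - n.-1.
have ve : v = nseq n.-1 true -> win n.-1 x e = v.
  move=> ->; rewrite -martin_end /win /e take_oversize //.
  by rewrite size_drop; have := nsize_martin; lia.
case: (posnP i) => [i0|i0].
  have v1 : v = nseq n.-1 true by rewrite -vi i0 martin_prefix.
  by apply: (martin_two (i := j) (j := e)) => //; try lia; apply: ve.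
case: (posnP j) => [j0|j0].
  have v1 : v = nseq n.-1 true by rewrite -vj j0 martin_prefix.
  by apply: (martin_two (i := i) (j := e)) => //; try lia; apply: ve.
by apply: (martin_two (i := i) (j := j)) => //; lia.
Qed.

(* Going backwards from [1^(n-1)]: if both successors of a string have been used
   then so have both predecessors, and since 0 is preferred, an edge labelled 1
   is used only after the edge labelled 0 from the same string. *)
Lemma martin_complete (w : seq bool) : size w = n -> w \in windows n x.
Proof.
have pref0 : forall v : seq bool, rcons v true \in windows n x -> rcons v false \in windows n x.
  by case: (martin_invP n0).
have main k (s : seq bool) b : k <= n.-1 -> size s = k ->
    rcons (s ++ nseq (n.-1 - k) true) b \in windows n x.
  elim: k s b => [|k IH] [|a s] b //= hk.
    by rewrite subn0 -martin_end => _; exact: martin_stuck.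
  case=> es.
  (* [martin_into] puts a bit in front of a string that still ends in 1. Read as a string with one
     final 1 fewer, extended by [true], the result is the case [b = true]; [pref0] then yields
     [b = false]. *)
  have h1 : rcons (a :: s ++ nseq (n.-1 - k.+1) true) true \in windows n x.
    have := martin_into a (IH s false (ltnW hk) es) (IH s true (ltnW hk) es).
    rewrite (_ : nseq _ _ = rcons (nseq (n.-1 - k.+1) true) true).
      by rewrite -rcons_cat -rcons_cons.
    rewrite -cats1 -[[:: true]]/(nseq 1 true) -nseqD; congr nseq; lia.
  by rewrite -rcons_cons; case: b; [exact: h1 | exact: pref0].
case/lastP: w => [|w b]; first by move=> /= e; move: n0; rewrite -e.
rewrite size_rcons => e; have := main n.-1 w b (leqnn _) ltac:(lia).
by rewrite subnn cats0.
Qed.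

Lemma size_martin : size x = 2 ^ n + n.-1.
Proof.
have h1 := card_strings martin_uniq (@windows_size_mem _ _).
have h2 := card_strings_ge martin_complete.
case: (leqP n (size x)) => h; first by rewrite size_windows // in h1 h2; lia.
by move: h2; rewrite /windows [n <= _]leqNgt h /= leqn0 expn_eq0.
Qed.

Lemma size_db : size (db n) = 2 ^ n.
Proof. by rewrite /db -/(martin n) size_drop -/x size_martin addnK. Qed.

(** By [martin_end] the deleted prefix repeats the last [n - 1] bits, so [x] reads the cyclic word
    [db n] starting [n - 1] places before its origin. *)
Lemma nth_martin t : t < 2 ^ n + n.-1 ->
  nth false x t = nth false (db n) ((t + 2 ^ n - n.-1) %% 2 ^ n).
Proof.
move=> ht; have n2 : n.-1 < 2 ^ n by apply: leq_trans (ltn_expl n (ltnSn 1)); lia.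
rewrite /db -/(martin n) -/x nth_drop.
case: (ltnP t n.-1) => h; last first.
  have -> : t + 2 ^ n - n.-1 = (t - n.-1) + 2 ^ n by lia.
  by rewrite modnDr modn_small; [congr nth|]; lia.
rewrite modn_small; last by lia.
have -> : n.-1 + (t + 2 ^ n - n.-1) = (size x - n.-1) + t by rewrite size_martin; lia.
rewrite -nth_drop -/(suff _ _) martin_end -(nth_take false h) -{1}[x]drop0.
by rewrite -/(win _ _ 0) martin_prefix.
Qed.

Lemma db_inj p q :
  (forall e, e < n -> nth false (db n) ((p + e) %% 2 ^ n) = nth false (db n) ((q + e) %% 2 ^ n)) ->
  p = q %[mod 2 ^ n].
Proof.
move=> h; have n2 : n.-1 < 2 ^ n by apply: leq_trans (ltn_expl n (ltnSn 1)); lia.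
have N0 : 0 < 2 ^ n by rewrite expn_gt0.
(* [t r] is where the cyclic window of [db n] at [r] starts in [x]: the deleted prefix shifts
   positions by [n - 1], and the reduction keeps the window inside [x]. *)
pose t r := (r + n.-1) %% 2 ^ n.
have tlt r : t r < 2 ^ n by rewrite ltn_mod.
have tE r e : e < n -> nth false x (t r + e) = nth false (db n) ((r + e) %% 2 ^ n).
  move=> he; rewrite nth_martin; last by have := tlt r; lia.
  congr nth; rewrite -addnBA; last by lia.
  rewrite /t -addnA modnDml -addnA [n.-1 + _]addnCA subnKC; last by lia.
  by rewrite addnA modnDr.
have : t p = t q.
  apply: (win_inj martin_uniq); rewrite ?size_martin; try (have := tlt p; have := tlt q; lia).
  apply: (@eq_from_nth _ false).
    by rewrite !size_win // size_martin; have := tlt p; have := tlt q; lia.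
  move=> e; rewrite size_win => [he|]; last by rewrite size_martin; have := tlt p; lia.
  by rewrite !nth_take // !nth_drop !tE // h.
by rewrite /t => /eqP; rewrite eqn_modDr => /eqP.
Qed.

Lemma db_complete (w : seq bool) : size w = n -> infix w (db n ++ db n).
Proof.
move=> sw; have n2 : n.-1 < 2 ^ n by apply: leq_trans (ltn_expl n (ltnSn 1)); lia.
have /mem_windows[i hi ei] := martin_complete sw.
rewrite -/x size_martin in hi.
pose p := (i + 2 ^ n - n.-1) %% 2 ^ n.
have N0 : 0 < 2 ^ n by rewrite expn_gt0.
have pN : p < 2 ^ n by rewrite ltn_mod.
suff -> : w = take n (drop p (db n ++ db n)).
  by apply: infix_trans (infix_take _ _ ) (infix_drop _ _).
apply: (@eq_from_nth _ false).
  by rewrite size_take size_drop size_cat size_db sw; case: ltnP; lia.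
move=> e; rewrite sw => he; rewrite nth_take // nth_drop -ei /win nth_take // nth_drop.
rewrite -/x nth_martin; last by lia.
have -> : i + e + 2 ^ n - n.-1 = (i + 2 ^ n - n.-1) + e by lia.
rewrite -modnDml -/p nth_cat size_db; case: ltnP => h; first by rewrite modn_small.
by rewrite -{1}(subnK h) modnDr modn_small //; lia.
Qed.

End Stuck.

(** * The sequence S *)

Definition dbc (n p : nat) := nth false (db n) (p %% 2 ^ n).

Lemma dbcD n p : dbc n (p + 2 ^ n) = dbc n p.
Proof. by rewrite /dbc modnDr. Qed.

(** [rot] by more than the length is the identity, hence the [else 0]; with it, rotation amounts
    need no bound. *)
Lemma nth_db_rot n i o : 0 < n -> o < 2 ^ n ->
  nth false (rot i (db n)) o = dbc n ((if i <= 2 ^ n then i else 0) + o).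
Proof.
move=> n0 ho; case: ifP => hi; last first.
  by rewrite rot_oversize ?size_db // ?dbc ?add0n /dbc ?modn_small //; lia.
rewrite /rot nth_cat size_drop size_db // nth_drop /dbc; case: ltnP => h.
  by rewrite modn_small //; lia.
rewrite nth_take; last by lia.
have -> : i + o = (o - (2 ^ n - i)) + 2 ^ n by lia.
by rewrite modnDr modn_small //; lia.
Qed.

Lemma Sseg_rots n : 0 < n ->
  exists2 r : seq nat, size r = n & Sseg n = flatten [seq rot i (db n) | i <- r].
Proof.
move=> n0; exists (flatten [seq nseq (odd_part n) i | i <- iota 0 (2 ^ two_val n)]).
  rewrite size_flatten /shape -map_comp.
  rewrite (eq_map (g := fun=> odd_part n)); last by move=> i /=; rewrite size_nseq.
  have -> m (s : seq nat) : sumn [seq m | _ <- s] = m * size s.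
    by elim: s => [|? s IH] /=; rewrite ?muln0 // IH mulnS.
  by rewrite size_iota /odd_part /two_val divnK // pfactor_dvdnn.
rewrite /Sseg; elim: (iota 0 _) => [//|i s IH] /=.
by rewrite map_cat flatten_cat -IH /Bblock map_nseq.
Qed.

Lemma size_Sseg n : 0 < n -> size (Sseg n) = n * 2 ^ n.
Proof.
move=> n0; have [r sr ->] := Sseg_rots n0; rewrite -{2}sr -(size_db n0) {sr}.
by elim: r => [//|i r IH] /=; rewrite size_cat size_rot IH mulSn.
Qed.

(** [sh a] is the rotation of copy [a]. The offset of [j] in its copy can be replaced by [j] itself
    because [dbc] has period [2 ^ n]. *)
Lemma nth_Sseg n : 0 < n -> exists sh : nat -> nat, forall j, j < n * 2 ^ n ->
  nth false (Sseg n) j = dbc n (sh (j %/ 2 ^ n) + j).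
Proof.
move=> n0; have [r sr ->] := Sseg_rots n0.
have N0 : 0 < 2 ^ n by rewrite expn_gt0.
pose c i := if i <= 2 ^ n then i else 0.
exists (fun a => c (nth 0 r a)) => j; rewrite -{1}sr {sr}.
elim: r j => [|i r IH] j /=; first by rewrite mul0n.
rewrite mulSn nth_cat size_rot size_db // => hj; case: ltnP => h.
  by rewrite divn_small //= nth_db_rot.
rewrite IH; last by lia.
rewrite -{3 4}(subnK h) divnDr ?dvdnn // divnn N0 addn1 /=.
by rewrite addnA dbcD.
Qed.

Lemma size_Sprefix n : size (Sprefix n) <= n * 2 ^ n.
Proof.
case: n => [//|n]; rewrite /Sprefix /=; elim: n => [//|n IH].
rewrite -[X in iota 1 X]addn1 iotaD map_cat flatten_cat size_cat /= cats0 add1n size_Sseg //.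
rewrite [2 ^ n.+2]expnS; move: (size _) (2 ^ n.+1) IH => a b; nia.
Qed.

Lemma infix_flatten (T : eqType) (s : seq T) ss : s \in ss -> infix s (flatten ss).
Proof.
elim: ss => //= t ss IH; rewrite in_cons => /orP[/eqP <-|/IH h].
  exact: prefix_infix.
exact: infix_trans h (suffix_infix _ _).
Qed.

(** For odd [k] the segment [Sseg k] is [k] unrotated copies of [db k], and two adjacent ones
    contain every string of length [k]. *)
Lemma Sprefix_full n (w : seq bool) : 5 <= n -> size w <= n - 2 ->
  infix w (Sprefix n).
Proof.
(* One of [n - 1] and [n - 2] is odd; [5 <= n] makes it at least 3, so that there are two adjacent
   copies. *)
move=> n5 hw; pose k := if odd n.-1 then n.-1 else n - 2.
have [ko k3 kn wk] : [/\ odd k, 3 <= k, k < n & size w <= k].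
  by rewrite /k; case: ifP => h; split; lia.
have h1 : infix (Sseg k) (Sprefix n).
  apply: infix_flatten; apply/mapP; exists k => //; rewrite mem_iota; lia.
have h2 : infix (db k ++ db k) (Sseg k).
  have e0 : two_val k = 0 by apply: logn_coprime; rewrite coprime2n.
  rewrite /Sseg e0 /= cats0 /Bblock /odd_part -/(two_val k) e0 divn1 /db_rot rot0.
  case: (k) k3 => [//|[//|m]] _ /=; rewrite catA.
  exact: prefix_infix.
apply: infix_trans (infix_trans h2 h1).
have /(infix_trans _): infix (w ++ nseq (k - size w) true) (db k ++ db k).
  by apply: db_complete; rewrite ?size_cat ?size_nseq; lia.
by apply; exact: prefix_infix.
Qed.

(** * The cost of one segment *)

Definition rsum (f : nat -> R) (s : seq nat) : R := foldr Rplus R0 [seq f i | i <- s].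

Lemma rsum_le f g (s : seq nat) :
  (forall i, i \in s -> Rle (f i) (g i)) -> Rle (rsum f s) (rsum g s).
Proof.
rewrite /rsum; elim: s => [|i s IH] h /=; first exact: Rle_refl.
apply: Rplus_le_compat; first by apply: h; rewrite mem_head.
by apply: IH => j hj; apply: h; rewrite in_cons hj orbT.
Qed.

Lemma rsum_add f g s : rsum (fun i => Rplus (f i) (g i)) s = Rplus (rsum f s) (rsum g s).
Proof. by rewrite /rsum; elim: s => [|i s IH] /=; rewrite ?IH; lra. Qed.

Lemma rsum_scale c f s : rsum (fun i => Rmult c (f i)) s = Rmult c (rsum f s).
Proof. by rewrite /rsum; elim: s => [|i s IH] /=; rewrite ?IH; lra. Qed.

Lemma rsum_const c s : rsum (fun=> c) s = Rmult (INR (size s)) c.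
Proof. by rewrite /rsum; elim: s => [|i s IH]; rewrite ?[size _]/= ?S_INR /= ?IH; lra. Qed.

Lemma rsum_count (P : pred nat) c s :
  rsum (fun i => if P i then c else R0) s = Rmult (INR (count P s)) c.
Proof.
rewrite /rsum; elim: s => [|i s IH] /=; first by lra.
by rewrite IH plus_INR; case: (P i) => /=; lra.
Qed.

Lemma rsum_INR (f : nat -> nat) s :
  rsum (fun i => INR (f i)) s = INR (sumn [seq f i | i <- s]).
Proof. by rewrite /rsum; elim: s => [|i s IH] //=; rewrite IH plus_INR. Qed.

Lemma rsum_rcons f s i : rsum f (rcons s i) = Rplus (rsum f s) (f i).
Proof. by rewrite /rsum; elim: s => [|j s IH] /=; rewrite ?IH; lra. Qed.

Lemma rsum_update f g (s : seq nat) i : uniq s -> i \in s ->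
  (forall j, j != i -> g j = f j) ->
  rsum g s = Rplus (rsum f s) (Rminus (g i) (f i)).
Proof.
move=> + + h; have same t : i \notin t -> rsum g t = rsum f t.
  rewrite /rsum; elim: t => //= j t IH; rewrite in_cons => /norP[ij /IH ->].
  by rewrite h // eq_sym.
elim: s => //= j s IH /andP[js us]; rewrite in_cons => /orP[/eqP e|si].
  rewrite -/(rsum f (j :: s)) /rsum /= -!/(rsum _ _) -e same ?e //; lra.
rewrite /rsum /= -!/(rsum _ _) IH // h; first by lra.
by apply: contraNneq js => ->.
Qed.

Lemma occ_cat_le w x y : occ w x <= occ w (x ++ y).
Proof.
elim: x => [|a x IH].
  by rewrite occ_nil; case: w => //; rewrite occ_infix infix0s.
rewrite cat_cons !occ_cons leq_add //; case h: (prefix w _) => //.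
by rewrite -cat_cons (prefix_trans h) // prefix_prefix.
Qed.

Lemma count_le_occ w x (s : seq nat) : uniq s ->
  (forall i, i \in s -> i <= size x /\ prefix w (drop i x)) -> size s <= occ w x.
Proof.
move=> us hs; rewrite occE -size_filter; apply: uniq_leq_size => // i /hs[h1 h2].
by rewrite mem_filter h2 mem_iota ltnS.
Qed.

Lemma prefix_dropP w x i : i + size w <= size x ->
  (forall e, e < size w -> nth false x (i + e) = nth false w e) -> prefix w (drop i x).
Proof.
move=> h he; rewrite prefixE -/(win _ _ _).
apply/eqP/(@eq_from_nth _ false); rewrite size_win // => e hi.
by rewrite nth_take // nth_drop he.
Qed.

Lemma prefix_drop_nth (w x : seq bool) i e : prefix w (drop i x) -> e < size w ->
  nth false x (i + e) = nth false w e.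
Proof. by rewrite prefixE -nth_drop => /eqP h he; rewrite -[in RHS]h nth_take. Qed.

(** Double counting of the pairs [p], [u] with [a p u]. *)
Lemma sumn_count_exchange (T U : Type) (a : T -> U -> bool) (s : seq T) (t : seq U) B :
  (forall u, count (a^~ u) s <= B) -> sumn [seq count (a p) t | p <- s] <= B * size t.
Proof.
move=> h; elim: t => [|u t IH] /=; first by elim: s {h} => //= *; rewrite muln0.
rewrite mulnS; apply: leq_trans (leq_add (h u) IH).
by rewrite leq_eqVlt; apply/orP; left; apply/eqP; elim: s {h IH} => //= p s ->; lia.
Qed.

Lemma count_mem_sum (a : pred nat) (l : nat -> nat) (P s : seq nat) B :
  (forall p, count (fun j => a j && (l j == p)) s <= B) ->
  count (fun j => a j && (l j \in P)) s <= size P * B.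
Proof.
move=> h; elim: P => [|p P IH].
  by rewrite (eq_count (a2 := pred0)) ?count_pred0 // => j; rewrite /= andbF.
rewrite mulSn; apply: leq_trans (leq_add (h p) IH).
rewrite -count_predUI; apply: leq_trans (leq_addr _ _); apply: sub_count => j /=.
by rewrite in_cons; case: (a j).
Qed.

(** The tangent to [ln] at [a] without its constant [-1]; it comes from [u < exp u] at
    [u = t / a]. *)
Lemma ln_tangent a t : Rlt 0 a -> Rlt 0 t -> Rle (ln t) (Rplus (ln a) (Rdiv t a)).
Proof.
move=> a0 t0; have ta : Rlt 0 (Rdiv t a) by apply: Rdiv_lt_0_compat.
have e : Rplus (ln a) (ln (Rdiv t a)) = ln t.
  by rewrite -ln_mult //; congr ln; field; lra.
rewrite -e; apply: Rplus_le_compat_l; apply: Rlt_le.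
rewrite -[X in Rlt _ X]ln_exp; apply: ln_increasing => //.
by have := exp_ineq1 _ (Rgt_not_eq _ _ ta); lra.
Qed.

(** * Labels and visits in one segment *)

Section Segment.
Variables (n M : nat).
Hypotheses (n5 : 5 <= n) (nM : n <= M).
Let N := 2 ^ n.
(** [Sprefix_full] covers lengths up to [n - 2], and [bit_nats_full] needs all lengths up to
    [q.+1]. *)
Let q := n - 3.
Let H := Sprefix n.
Let seg := Sseg n.
Let Z := H ++ seg.
Let D := dbc n.
Variable sh : nat -> nat.
Hypothesis segE : forall j, j < n * N -> nth false seg j = D (sh (j %/ N) + j).

Let N0 : 0 < N. Proof. by rewrite expn_gt0. Qed.
Let n0 : 0 < n. Proof. by lia. Qed.
Let size_seg : size seg = n * N. Proof. exact: size_Sseg. Qed.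
Let x j := H ++ take j seg.

Definition regular j := M <= j %% N.
Definition label j := (sh (j %/ N) + j - M) %% N.
Definition ctxt p := mkseq (fun e => D (p + e)) M.
(** The last [q] bits of [ctxt p], to which [bit_nats_full] applies. *)
Definition shortctxt p := mkseq (fun e => D (p + (M - q) + e)) q.
(** Tested in the whole of [Z] and not in the part read so far, so that it depends on the label
    alone. *)
Definition conflict p := infix (rcons (ctxt p) (~~ D (p + M))) Z.
Definition visits p J := count (fun j => regular j && (label j == p)) (iota 0 J).

Let label_lt j : label j < N. Proof. by rewrite ltn_mod. Qed.

Let D_modl a b : D (a %% N + b) = D (a + b).
Proof. by rewrite /D /dbc modnDml. Qed.

Let D_inj p p' c : p < N -> p' < N ->
  (forall e, e < n -> D (p + c + e) = D (p' + c + e)) -> p = p'.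
Proof.
move=> hp hp' h; have /eqP : p + c = p' + c %[mod N] by apply: db_inj => // e he; exact: h.
by rewrite eqn_modDr !modn_small // => /eqP.
Qed.

Let size_x j : j <= n * N -> size (x j) = size H + j.
Proof. by move=> h; rewrite size_cat size_takel // size_seg. Qed.

Let x_infix j : infix (x j) Z.
Proof. by rewrite /Z -(cat_take_drop j seg) catA prefix_infix. Qed.

Let nth_x j i : i < j -> j <= n * N -> nth false (x j) (size H + i) = nth false seg i.
Proof.
by move=> ij hj; rewrite nth_cat ifF ?ltnNge ?leq_addr // addKn nth_take.
Qed.

(** At an offset of at least [M], the preceding [M] bits lie in the same copy as [j], hence under
    the same rotation [sh]. *)
Let seg_label j e : regular j -> j < n * N -> e <= M ->
  M <= j /\ nth false seg (j - M + e) = D (label j + e).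
Proof.
rewrite /regular => hr hj he; have Mj : M <= j by apply: leq_trans hr (leq_mod _ _).
split=> //; rewrite segE; last by lia.
rewrite D_modl; have -> : (j - M + e) %/ N = j %/ N; last by congr D; lia.
have dj := divn_eq j N; have mj : j %% N < N by rewrite ltn_mod.
have -> : j - M + e = (j %/ N) * N + (j %% N - (M - e)) by lia.
by rewrite divnMDl // (divn_small (leq_ltn_trans (leq_subr _ _) mj)) addn0.
Qed.

Let ctxt_suffix j : regular j -> j < n * N -> suffix (ctxt (label j)) (x j).
Proof.
move=> hr hj; have [Mj _] := seg_label hr hj (leq0n _).
have -> : ctxt (label j) = drop (size H + (j - M)) (x j); last exact: suffix_drop.
apply: (@eq_from_nth _ false); rewrite size_mkseq.
  by rewrite size_drop size_x; lia.
move=> e he; rewrite nth_mkseq // nth_drop -addnA nth_x; try lia.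
by have [_ ->] := seg_label hr hj (ltnW he).
Qed.

Let suff_x j : regular j -> j < n * N -> suff q (x j) = shortctxt (label j).
Proof.
move=> hr hj; have [Mj _] := seg_label hr hj (leq0n _).
have qM : q <= M by rewrite /q; lia.
apply: (@eq_from_nth _ false); rewrite ?size_mkseq /suff size_drop size_x; try lia.
move=> e he; have {}he : e < q by lia.
rewrite nth_mkseq // nth_drop.
have -> : size H + j - q + e = size H + (j - q + e) by lia.
rewrite nth_x; try lia.
have [_] := seg_label (e := M - q + e) hr hj ltac:(lia).
rewrite (_ : j - M + (M - q + e) = j - q + e); last by lia.
by move=> ->; rewrite addnA.
Qed.

(** Each earlier visit [i] gives an occurrence starting at [i - M], whose last bit has already been
    read because [i < j]. *)
Let visits_occ j : regular j -> j < n * N ->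
  visits (label j) j <= occ (rcons (ctxt (label j)) (D (label j + M))) (x j).
Proof.
move=> hr hj; rewrite /visits -size_filter -(size_map (fun i => size H + (i - M))).
apply: count_le_occ.
  rewrite map_inj_in_uniq ?filter_uniq ?iota_uniq // => i i'.
  rewrite !mem_filter !mem_iota => /andP[/andP[hi _] li] /andP[/andP[hi' _] li'].
  have [? _] := seg_label hi ltac:(lia) (leq0n _).
  have [? _] := seg_label hi' ltac:(lia) (leq0n _); lia.
move=> _ /mapP[i + ->]; rewrite mem_filter mem_iota => /andP[/andP[hi /eqP li] ij].
have [Mi _] := seg_label hi ltac:(lia) (leq0n _).
split; first by rewrite size_x; lia.
apply: prefix_dropP; rewrite size_rcons size_mkseq; first by rewrite size_x; lia.
move=> e he; rewrite -addnA nth_x; try lia.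
have [_ ->] := seg_label (e := e) hi ltac:(lia) ltac:(lia).
rewrite li nth_rcons size_mkseq; case: ltnP => h; first by rewrite nth_mkseq.
by have /eqP -> : e == M; rewrite ?eqxx // eqn_leq h -ltnS he.
Qed.

(** Inside one copy a label determines the position, so each of the [n] copies contributes at most
    one visit. *)
Let visits_le p : visits p (n * N) <= n.
Proof.
rewrite /visits -size_filter -(size_map (fun j => j %/ N)) -[X in _ <= X](size_iota 0).
apply: uniq_leq_size => [|_ /mapP[j + ->]]; last first.
  rewrite mem_filter !mem_iota => /andP[_ hj]; rewrite ltn_divLR //; lia.
rewrite map_inj_in_uniq ?filter_uniq ?iota_uniq // => j j'.
rewrite !mem_filter !mem_iota => /andP[/andP[hr /eqP lj] hj] /andP[/andP[hr' /eqP lj'] hj'] e.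
have [Mj _] := seg_label hr ltac:(lia) (leq0n _).
have [Mj' _] := seg_label hr' ltac:(lia) (leq0n _).
have : j = j' %[mod N].
  move: lj; rewrite -lj' /label e -!addnBA // => /eqP; rewrite eqn_modDl => /eqP h.
  by rewrite -(subnK Mj) -(subnK Mj') -modnDml h modnDml.
by rewrite {2}(divn_eq j N) {2}(divn_eq j' N) e => ->.
Qed.

Let full j (w : seq bool) : size w <= q.+1 -> 0 < occ w (x j).
Proof.
move=> hw; rewrite occ_infix; apply: infix_trans (prefix_infix _ _).
by apply: Sprefix_full => //; move: hw; rewrite /q; lia.
Qed.

Let occ_x_le w j : occ w (x j) <= occ w Z.
Proof.
by rewrite (_ : Z = x j ++ drop j seg) ?occ_cat_le // -catA cat_take_drop.
Qed.

(** An occurrence count is at most the length plus 1, and [bit_nats_full] adds 2. *)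
Definition costmax : R := Rmult 2 (ln (INR (size Z).+3)).
Definition firstcost p : R := Rmult 2 (ln (INR (occ (shortctxt p) Z).+2)).
(* Telescopes the costs of successive visits to label [p]: [firstcost p] for the
   first one and [ln (r + 1) - ln r] after [r > 0] visits. *)
Definition potential p k : R :=
  match k with 0 => R0 | k'.+1 => Rplus (firstcost p) (ln (INR k)) end.

Let costmax_ge0 : Rle 0 costmax.
Proof. by have := ln_INR_ge0 (size Z).+3; rewrite /costmax; lra. Qed.

Let cost_max j b : j <= n * N -> Rle (bit_nats (x j) b) costmax.
Proof.
move=> hj; apply: Rle_trans (bit_nats_full b (@full j)) _.
apply: Rmult_le_compat_l; first by lra.
apply: ln_INR_le => //; have := occ_le_size (suff q (x j)) (x j).
by rewrite size_x // /Z size_cat size_seg; lia.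
Qed.

Let cost_first j b : regular j -> j < n * N -> Rle (bit_nats (x j) b) (firstcost (label j)).
Proof.
move=> hr hj; apply: Rle_trans (bit_nats_full b (@full j)) _.
apply: Rmult_le_compat_l; first by lra.
by apply: ln_INR_le => //; rewrite suff_x // !ltnS occ_x_le.
Qed.

Let cost_good j : regular j -> j < n * N -> ~~ conflict (label j) ->
  Rle (bit_nats (x j) (nth false seg j))
      (Rminus (potential (label j) (visits (label j) j).+1)
              (potential (label j) (visits (label j) j))).
Proof.
move=> hr hj nc; have hv := visits_occ hr hj.
have [Mj eb] := seg_label hr hj (leqnn _); rewrite subnK // in eb.
case: (visits _ _) hv => [_|k hv].
  have := @cost_first j (nth false seg j) hr hj.
  by rewrite /potential; have := ln_INR_ge0 1; lra.
have := bit_nats_predicted (f := k.+1) (b := nth false seg j) (ctxt_suffix hr hj) isT.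
rewrite eb => /(_ hv); rewrite /potential [INR k.+2]S_INR.
suff e : occ (rcons (ctxt (label j)) (~~ D (label j + M))) (x j) = 0.
  by move=> /(_ e); lra.
apply/eqP; rewrite -leqn0 leqNgt occ_infix; apply: contra nc => h.
exact: infix_trans h (x_infix j).
Qed.

Let bad j := ~~ regular j || conflict (label j).

(** Increments of the potential are nonnegative, so they may be granted to conflicting regular bits
    as well; the sum over all regular bits then telescopes. *)
Let cost_le j : j < n * N ->
  Rle (bit_nats (x j) (nth false seg j))
      (Rplus (if bad j then costmax else R0)
             (if regular j then Rminus (potential (label j) (visits (label j) j).+1)
                (potential (label j) (visits (label j) j)) else R0)).
Proof.
move=> hj; have h0 := @cost_max j (nth false seg j) (ltnW hj).
rewrite /bad; set g := Rminus _ _; case hr: (regular j) => /=; last by lra.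
case hc: (conflict _); last by have := cost_good hr hj (negbT hc); rewrite -/g; lra.
suff : Rle 0 g by lra.
rewrite /g /potential; case: (visits _ _) => [|k].
  have := ln_INR_ge0 1; have := ln_INR_ge0 (occ (shortctxt (label j)) Z).+2.
  by rewrite /firstcost; lra.
by have := @ln_INR_le k.+1 k.+2 isT (leqnSn _); lra.
Qed.

Let visitsS p J : visits p J.+1 = visits p J + (regular J && (label J == p)).
Proof. by rewrite /visits -[J.+1]addn1 iotaD count_cat /= addn0. Qed.

(** A regular bit [J] changes only the visit count of its own label. *)
Let telescope J :
  rsum (fun j => if regular j then Rminus (potential (label j) (visits (label j) j).+1)
                (potential (label j) (visits (label j) j)) else R0) (iota 0 J) =
  rsum (fun p => potential p (visits p J)) (iota 0 N).
Proof.
elim: J => [|J IH].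
  rewrite [LHS]/= -[LHS](Rmult_0_r (INR (size (iota 0 N)))) -rsum_const.
  by rewrite /rsum; congr foldr; apply: eq_map => p.
have eJ : iota 0 J.+1 = rcons (iota 0 J) J by rewrite -[J.+1]addn1 iotaD cats1.
rewrite eJ rsum_rcons IH; case hr: (regular J); last first.
  rewrite Rplus_0_r /rsum; congr foldr; apply: eq_map => p.
  by rewrite visitsS hr addn0.
rewrite [RHS](rsum_update (f := fun p => potential p (visits p J)) (i := label J)).
- by rewrite visitsS hr eqxx addn1.
- exact: iota_uniq.
- by rewrite mem_iota /= add0n label_lt.
- by move=> p hp; rewrite visitsS hr eq_sym (negbTE hp) addn0.
Qed.

(** * Counting irregular bits and conflicting labels *)

Let count_irregular : count (fun j => ~~ regular j) (iota 0 (n * N)) <= n * M.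
Proof.
(* An irregular position is a pair of a copy number below [n] and an offset below [M], encoded as a
   number below [n * M]. *)
rewrite -size_filter -(size_map (fun j => (j %/ N) * M + j %% N)) -[X in _ <= X](size_iota 0).
have M0 : 0 < M by lia.
have lt j : j \in filter (fun j => ~~ regular j) (iota 0 (n * N)) -> j %% N < M /\ j %/ N < n.
  rewrite mem_filter mem_iota /regular -ltnNge => /andP[-> hj]; split=> //.
  by rewrite ltn_divLR //; lia.
apply: uniq_leq_size => [|_ /mapP[j /lt[h1 h2] ->]]; last first.
  rewrite mem_iota add0n leq0n /=; apply: (@leq_trans ((j %/ N).+1 * M)).
    by rewrite mulSn addnC ltn_add2r.
  by rewrite leq_mul2r h2 orbT.
rewrite map_inj_in_uniq ?filter_uniq ?iota_uniq // => j j' /lt[h1 _] /lt[h2 _] e.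
have e1 := congr1 (fun k => k %/ M) e; have e2 := congr1 (fun k => k %% M) e.
rewrite /= !divnMDl // !(divn_small h1) !(divn_small h2) !addn0 in e1.
rewrite /= !modnMDl !(modn_small h1) !(modn_small h2) in e2.
by rewrite (divn_eq j N) e1 e2 -divn_eq.
Qed.

Let conflicts := filter conflict (iota 0 N).
Let flip p := rcons (ctxt p) (~~ D (p + M)).
Let pos p := find (fun i => prefix (flip p) (drop i Z)) (iota 0 (size Z).+1).

Let posP p : conflict p -> pos p <= size Z /\
  (forall e, e < M -> nth false Z (pos p + e) = D (p + e)) /\
  nth false Z (pos p + M) = ~~ D (p + M).
Proof.
rewrite /conflict -occ_infix occE -has_count => hp.
have hl := hp; rewrite has_find size_iota ltnS -/(pos p) in hl.
have := nth_find 0 hp; rewrite -/(pos p) nth_iota ?ltnS // add0n => pf.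
have hn e := prefix_drop_nth (e := e) pf; rewrite size_rcons size_mkseq in hn.
split=> //; split=> [e he|].
  by rewrite hn 1?ltnW // nth_rcons size_mkseq he nth_mkseq.
by rewrite hn // nth_rcons size_mkseq ltnn eqxx.
Qed.

(* If [pos p < pos p' <= pos p + (M - n)], the common part of the two windows
   contains [n] consecutive bits of the periodic de Bruijn word, which force
   [p'] to be the shift of [p]; the flipped bit of the first window then
   contradicts the second window. *)
Let conflict_sep p p' : p < N -> p' < N -> conflict p -> conflict p' ->
  pos p <= pos p' -> pos p' - pos p <= M - n -> p = p'.
Proof.
move=> hp hp' /posP[_ [h1 h2]] /posP[_ [h1' h2']] le sep.
set d := pos p' - pos p in sep.
have ed : pos p' = pos p + d by rewrite subnKC.
have shift e : e < n -> D (p + d + e) = D (p' + e).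
  move=> he; rewrite -h1'; last by lia.
  by rewrite ed -addnA -h1 ?addnA //; lia.
case: (posnP d) => d0.
  apply: (D_inj (c := 0)) => // e he.
  by have := shift e he; rewrite d0 !addn0.
have /eqP pp : p + d = p' %[mod N] by apply: db_inj => // e he; exact: shift.
have dM : d < M by lia.
have e1 := h1' (M - d) ltac:(lia).
rewrite ed -addnA subnKC ?(ltnW dM) // h2 in e1.
have e2 : D (p + M) = D (p' + (M - d)).
  have -> : p + M = p + d + (M - d) by lia.
  by rewrite -D_modl (eqP pp) D_modl.
by move: e1; rewrite -e2; case: (D _).
Qed.

(** Cut [Z] into buckets of length [M - n + 1]: two positions in one bucket differ by at most
    [M - n], so by [conflict_sep] each bucket holds [pos p] for at most one label. *)
Let size_conflicts : size conflicts <= (size Z %/ (M - n).+1).+1.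
Proof.
rewrite -(size_map (fun p => pos p %/ (M - n).+1)) -[X in _ <= X](size_iota 0).
have cP p : p \in conflicts -> conflict p /\ p < N.
  by rewrite mem_filter mem_iota add0n => /andP[-> /andP[_ ->]].
apply: uniq_leq_size => [|_ /mapP[p /cP[hp _] ->]]; last first.
  by rewrite mem_iota add0n ltnS leq_div2r //; case: (posP hp).
have near (a b d : nat) : a %/ d.+1 = b %/ d.+1 -> b - a <= d.
  move=> e; have := divn_eq a d.+1; have := divn_eq b d.+1; rewrite e.
  have := ltn_pmod b (ltn0Sn d); have := ltn_pmod a (ltn0Sn d); lia.
rewrite map_inj_in_uniq ?filter_uniq ?iota_uniq // => p p' /cP[hp lp] /cP[hp' lp'] e.
case: (leqP (pos p) (pos p')) => h; first by apply: conflict_sep => //; apply: near.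
by apply/esym; apply: conflict_sep => //; [exact: ltnW | apply: near].
Qed.

Let count_bad : count bad (iota 0 (n * N)) <= n * M + (size Z %/ (M - n).+1).+1 * n.
Proof.
have -> : count bad (iota 0 (n * N)) =
    count (predU (fun j => ~~ regular j) (fun j => regular j && (label j \in conflicts)))
      (iota 0 (n * N)).
  apply: eq_count => j; rewrite /bad /= mem_filter mem_iota add0n label_lt andbT.
  by rewrite leq0n andbT; case: (regular j).
rewrite -[X in X <= _](addnK (count (predI (fun j => ~~ regular j)
  (fun j => regular j && (label j \in conflicts))) (iota 0 (n * N)))) count_predUI.
apply: leq_trans (leq_subr _ _) (leq_add count_irregular _).
apply: leq_trans (count_mem_sum conflicts visits_le) _.
by rewrite leq_mul2r size_conflicts orbT.
Qed.

(** Labels whose short context occurs at the same place of [Z] agree on [n - 3] consecutive bits of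
    the cyclic word; the next three bits then determine the label, so there are at most 8 of
    them. *)
Let sum_occ : sumn [seq occ (shortctxt p) Z | p <- iota 0 N] <= 8 * (size Z).+1.
Proof.
rewrite (eq_map (g := fun p => count (fun i => prefix (shortctxt p) (drop i Z))
  (iota 0 (size Z).+1))); last by move=> p; rewrite occE.
rewrite -[X in 8 * X](size_iota 0); apply: sumn_count_exchange => i.
have qM : q + 3 = n by rewrite /q; lia.
pose f p := (D (p + M), D (p + M.+1), D (p + M.+2)).
rewrite -size_filter -(size_map f).
suff u : uniq [seq f p | p <- iota 0 N & prefix (shortctxt p) (drop i Z)].
  rewrite -(card_uniqP u); apply: leq_trans (max_card _) _.
  by rewrite !card_prod card_bool.
rewrite map_inj_in_uniq ?filter_uniq ?iota_uniq // => p p'.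
rewrite !mem_filter !mem_iota !add0n => /andP[hp /andP[_ lp]] /andP[hp' /andP[_ lp']] [e0 e1 e2].
apply: (D_inj (c := M - q)) => // e he; case: (ltnP e q) => h.
  have := prefix_drop_nth (e := e) hp; have := prefix_drop_nth (e := e) hp'.
  by rewrite !size_mkseq !nth_mkseq // => <- // <-.
have [k [hk ->]] : exists k, k < 3 /\ e = q + k by exists (e - q); lia.
have er r : r + (M - q) + (q + k) = r + (M + k) by lia.
by rewrite !er; case: k hk {er} => [|[|[|//]]] _; rewrite ?addn0 ?addn1 ?addn2.
Qed.

Let size_Z : size Z <= 2 * (n * N).
Proof. by rewrite size_cat size_seg; have := size_Sprefix n; rewrite -/H -/N; lia. Qed.

(** The first summand charges [costmax] to each bad bit. The rest bounds the final potentials, at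
    most [firstcost p + ln n] for each label. *)
Lemma segment_cost :
  Rle (Rmult (ppm_cost H seg) (ln 2))
   (Rplus (Rmult (INR (n * M + (size Z %/ (M - n).+1).+1 * n)) (Rmult 2 (ln (INR (size Z).+3))))
     (Rplus (Rmult (Rmult 3 (INR N)) (ln (INR n))) (Rmult 52 (INR N)))).
Proof.
have -> : Rmult (ppm_cost H seg) (ln 2) =
    rsum (fun j => bit_nats (x j) (nth false seg j)) (iota 0 (n * N)).
  rewrite /ppm_cost size_seg -/(rsum _ _) Rmult_comm -rsum_scale.
  by rewrite /rsum; congr foldr; apply: eq_map => j; rewrite /bit_nats Rmult_comm.
apply: Rle_trans (rsum_le (g := fun j => Rplus _ _) _) _.
  by move=> j; rewrite mem_iota add0n => /andP[_]; exact: cost_le.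
rewrite rsum_add rsum_count telescope -/costmax.
apply: Rplus_le_compat.
  by apply: Rmult_le_compat_r => //; apply: le_INR; apply/leP; exact: count_bad.
have n_gt0 : Rlt 0 (INR n) by apply: lt_0_INR; lia.
(* The slope at [n] of twice the logarithm: with [k] occurrences of the short context,
   [firstcost p <= 2 ln n + c (k + 2)]. *)
pose c := Rdiv 2 (INR n).
apply: Rle_trans (rsum_le (g := fun p => Rplus (Rplus (Rmult 3 (ln (INR n))) (Rmult 2 c))
   (Rmult c (INR (occ (shortctxt p) Z)))) _) _.
  move=> p _; have L0 := ln_INR_ge0 n; set k := occ _ _.
  have k0 : Rle 0 (INR k) by exact: pos_INR.
  have h := @ln_tangent (INR n) (INR k.+2) n_gt0 ltac:(apply: lt_0_INR; lia).
  have h' : Rle (firstcost p) (Rplus (Rmult 2 (ln (INR n))) (Rplus (Rmult 2 c) (Rmult c (INR k)))).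
    rewrite /firstcost -/k; apply: Rle_trans (Rmult_le_compat_l _ _ _ _ h) _; first by lra.
    by rewrite !S_INR /c; right; field; lra.
  have f0 : Rle 0 (firstcost p).
    by have := ln_INR_ge0 k.+2; rewrite /firstcost -/k; lra.
  case e: (visits p (n * N)) => [|m]; rewrite /potential; first by lra.
  have := @ln_INR_le m.+1 n isT ltac:(rewrite -e; exact: visits_le); lra.
rewrite rsum_add rsum_const rsum_scale rsum_INR size_iota.
(* [24 = 8 * 3], from [size Z + 1 <= 3 n N]. Multiplied by [c = 2 / n] this gives [48 N]; the terms
   [2 c] add at most [4 N], whence 52. *)
have hs : Rle (INR (sumn [seq occ (shortctxt p) Z | p <- iota 0 N])) (INR (24 * (n * N))).
  apply: le_INR; apply/leP; apply: leq_trans sum_occ _.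
  have : 0 < n * N by rewrite muln_gt0 n0. have := size_Z; lia.
have c0 : Rlt 0 c by apply: Rdiv_lt_0_compat; lra.
apply: Rle_trans (Rplus_le_compat_l _ _ _ (Rmult_le_compat_l _ _ _ (Rlt_le _ _ c0) hs)) _.
have c1 : Rle c 2.
  have : Rle 1 (INR n) by apply: (le_INR 1); lia.
  move=> h1; rewrite /c; apply: (Rmult_le_reg_r (INR n)) => //.
  by rewrite /Rdiv Rmult_assoc Rinv_l; lra.
rewrite !mult_INR (_ : Rmult c _ = Rmult 48 (INR N)); last first.
  have -> : INR 24 = IZR 24 by rewrite INR_IZR_INZ.
  by rewrite /c; field; lra.
have N_ge0 := pos_INR N.
by have := Rmult_le_compat_l _ _ _ N_ge0 c1; lra.
Qed.

End Segment.

(** * Numerical estimates and conclusion *)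

Lemma poly_le_expn n : 48 <= n -> 8 * n ^ 6 <= 2 ^ n.
Proof.
(* Since [n < 16 (m + 1) <= 2 ^ (m + 4)], it is enough that [3 + 6 (m + 4) <= 16 m], which holds
   from [m = 3] on. *)
move=> hn; set m := n %/ 16.
have m3 : 3 <= m by rewrite /m; lia.
have h1 : n <= 2 ^ (m + 4).
  rewrite expnD; have : m < 2 ^ m by exact: ltn_expl.
  have : n < 16 * m.+1 by rewrite /m; lia.
  by rewrite (_ : 2 ^ 4 = 16) //; lia.
apply: (@leq_trans (2 ^ 3 * 2 ^ ((m + 4) * 6))).
  by rewrite leq_mul2l expnM leq_exp2r.
by rewrite -expnD leq_exp2l // /m; lia.
Qed.

Lemma ln2_lt1 : Rlt (ln 2) 1.
Proof.
rewrite -[X in Rlt _ X]ln_exp; apply: ln_increasing; first by lra.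
by have := exp_ineq1 1 ltac:(lra); lra.
Qed.

Lemma ln_INR_expn n k : 0 < n -> ln (INR (n ^ k)) = Rmult (INR k) (ln (INR n)).
Proof.
move=> n0; have hn : Rlt 0 (INR n) by apply: lt_0_INR; apply/leP.
elim: k => [|k IH]; first by rewrite /= ln_1; lra.
rewrite expnS mult_INR ln_mult // ?IH ?S_INR; first by lra.
by apply: lt_0_INR; apply/leP; rewrite expn_gt0 n0.
Qed.

(** [61 = 52 + 9]: with [M = n ^ 4] the bad bits cost at most [9 * 2 ^ n]. *)
Lemma segment_cost_le n : 48 <= n ->
  Rle (Rmult (ppm_cost (Sprefix n) (Sseg n)) (ln 2))
      (Rmult (INR (2 ^ n)) (Rplus (Rmult 3 (ln (INR n))) 61)).
Proof.
move=> hn; have n5 : 5 <= n by lia.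
have n_gt0 : 0 < n by lia.
have nM : n <= n ^ 4 by rewrite -{1}[n]expn1 leq_pexp2l.
have [sh hsh] := nth_Sseg n_gt0.
apply: Rle_trans (segment_cost n5 nM hsh) _.
set z := size _; set N := 2 ^ n.
have big : 8 * n ^ 6 <= N by exact: poly_le_expn.
have zle : z <= 2 * (n * N).
  by rewrite /z size_cat size_Sseg // -/N; have := size_Sprefix n; rewrite -/N; lia.
set k := z %/ _.
(* Follows from [M - n + 1 >= n ^ 3] and [z <= 2 n N]. *)
have kle : n ^ 2 * k <= 2 * N.
  have h1 : n ^ 3 <= (n ^ 4 - n).+1.
    have : n ^ 4 = n * n ^ 3 by rewrite -expnS.
    have : n <= n ^ 3 by rewrite -{1}[n]expn1 leq_pexp2l.
    by move: (n ^ 3) (n ^ 4) => a b; nia.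
  have h2 : k * n ^ 3 <= 2 * (n * N).
    apply: leq_trans zle; apply: leq_trans (leq_divM z (n ^ 4 - n).+1).
    by rewrite leq_mul2l h1 orbT.
  rewrite -(leq_pmul2l n_gt0) mulnA -expnS mulnC; apply: leq_trans h2 _.
  by rewrite mulnCA.
have hL : Rle (ln (INR z.+3)) (Rmult 2 (INR n)).
  apply: (@Rle_trans _ (ln (INR (2 ^ (n + n))))).
    apply: ln_INR_le => //; rewrite expnD -/N.
    have : 2 * n + 3 <= N.
      apply: leq_trans big; apply: (@leq_trans (8 * n)); first by lia.
      by rewrite leq_mul2l -{1}[n]expn1 leq_pexp2l.
    by move: zle; nia.
  have e2 : INR 2 = IZR 2 by rewrite INR_IZR_INZ.
  rewrite ln_INR_expn // plus_INR e2; have := ln2_lt1; have := ln2_gt0; have := pos_INR n; nra.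
(* The factor [4 * n] bounds [2 ln (z + 3)]. Of [9 N], the share [8 N] bounds [4 n^2 k] by [kle],
   and [N] bounds [4 n^6 + 4 n^2]. *)
have hB : Rle (INR ((n * n ^ 4 + k.+1 * n) * (4 * n))) (INR (9 * N)).
  apply: le_INR; apply/leP.
  have -> : (n * n ^ 4 + k.+1 * n) * (4 * n) = 4 * n ^ 6 + 4 * n ^ 2 + 4 * (n ^ 2 * k).
    by rewrite (expnD n 2 4) (expnD n 1 1) expn1; move: (n ^ 4) => a; nia.
  have : n ^ 2 <= n ^ 6 by rewrite leq_pexp2l.
  by move: (n ^ 6) (n ^ 2 * k) (n ^ 2) big kle => a b c; lia.
have h0 := ln_INR_ge0 z.+3.
set B := INR (_ + _) in hB *.
have B0 : Rle 0 B by exact: pos_INR.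
move: hB; rewrite [INR (_ * (4 * n))]mult_INR -/B !mult_INR => hB.
have e4 : INR 4 = IZR 4 by rewrite INR_IZR_INZ.
have e9 : INR 9 = IZR 9 by rewrite INR_IZR_INZ.
rewrite e4 e9 in hB.
have h2 : Rle (Rmult 2 (ln (INR z.+3))) (Rmult 4 (INR n)) by lra.
have := Rmult_le_compat_l _ _ _ B0 h2.
have := pos_INR N; lra.
Qed.

Theorem theorem1 :
  exists N : nat, forall n : nat, (N <= n)%N ->
    Rle (ppm_cost (Sprefix n) (Sseg n))
        (Rplus (Rmult (INR (2 ^ n + 2 * n + n ^ 2)) (log2 (INR (n ^ 5))))
               (log2 (INR ((n - 1) ^ n * n ^ (2 ^ n.+1))))).
Proof.
(* From [exp 31] on, [ln n >= 31], so [61 <= 2 ln n] and [3 ln n + 61] fits into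
   [5 ln n = ln (n^5)]. *)
have [m hm] := INR_unbounded (exp 31).
exists (maxn 48 m) => n; rewrite geq_max => /andP[n48 mn].
have n_gt0 : 0 < n by lia.
have L31 : Rle 31 (ln (INR n)).
  rewrite -[X in Rle X _]ln_exp; apply: ln_le; first exact: exp_pos.
  by have := le_INR m n ltac:(lia); lra.
have l2 := ln2_gt0.
apply: (Rmult_le_reg_r (ln 2)) => //.
apply: Rle_trans (segment_cost_le n48) _.
have elog (y : R) : Rmult (log2 y) (ln 2) = ln y by rewrite /log2; field; lra.
rewrite Rmult_plus_distr_r Rmult_assoc !elog ln_INR_expn //.
have e5 : INR 5 = IZR 5 by rewrite INR_IZR_INZ.
rewrite e5; have := ln_INR_ge0 ((n - 1) ^ n * n ^ 2 ^ n.+1).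
have hN : Rle (INR (2 ^ n)) (INR (2 ^ n + 2 * n + n ^ 2)).
  by apply: le_INR; apply/leP; rewrite -addnA leq_addr.
have h5 : Rle 0 (Rmult 5 (ln (INR n))) by lra.
have h1 := Rmult_le_compat_r _ _ _ h5 hN.
have h3 : Rle (Rplus (Rmult 3 (ln (INR n))) 61) (Rmult 5 (ln (INR n))) by lra.
have h2 := Rmult_le_compat_l _ _ _ (pos_INR (2 ^ n)) h3.
lra.
Qed.
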